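(* Let $n\ge1$ and let $D[b_1,\dots,b_n]$ be a standard braid-form diagram with $b_i>0$ for all $1\le i\le n$. Put $b_0=b_{-1}=0$. Then $$\mathcal{P}[b_1,\dots,b_n]=\sum_{f\in F}x_{f_l,\,b_{f_l}-t_{f_l}}\ \prod_{i\in\lambda(f)}\Lambda_i(f)\ \prod_{i\in\rho(f)}R_i(f)\ \prod_{i\in\gamma(f)}\Gamma_i(f),$$ where, writing $\beta_i=b_{f_i}-t_{f_i}$ and $s_i=(-1)^{f_i-1}$, $$\Lambda_i(f)=-\sum_{j=1}^{\beta_i}\ \sum_{k=0}^{\lfloor (j-1)/2\rfloor}(s_iz)^{j-2k}\,a^{s_i(j-\beta_i)}\binom{j-1-k}{k},$$ $$R_i(f)=a^{s_i b_{f_i-1}}\sum_{k=0}^{\lfloor \beta_i/2\rfloor}(s_iz)^{\beta_i-2k}\binom{\beta_i-k}{k},$$ $$\Gamma_i(f)=\sum_{k=0}^{\lfloor (\beta_i-1)/2\rfloor}(s_iz)^{\beta_i-1-2k}\binom{\beta_i-1-k}{k}$$ (empty sums are $0$ and empty products are $1$; in $R_i(f)$, $b_{f_i-1}$ denotes the entry with index $f_i-1$), and where: \begin{itemize} \item $F$ is the set of all strictly decreasing integer sequences $f=\{f_1,f_2,\dots,f_l\}$ with $f_1=n$, $f_i-f_{i+1}\in\{1,2\}$ for $1\le i<l$, $f_l\in\{0,-1\}$, and only one of $0$, $-1$ present in $f$ (that is, if $f_l=-1$ then $f_{l-1}\ne0$), in which each non-final term $f_i$ ($i<l$) carries one of two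 labels $c$ or $d$ (written $f_i=c_i$ or $f_i=d_i$), subject to: if $f_i=d_i$ then $f_i-f_{i+1}=1$. Sequences with different labels are different elements of $F$. \item $t_{f_1}=0$ and, for $i\ge2$, $t_{f_i}=1$ if $f_{i-1}=d_{i-1}$ and $t_{f_i}=0$ if $f_{i-1}=c_{i-1}$. \item $\lambda(f)=\{i\mid f_i=c_i,\ f_i-f_{i+1}=1\}$, $\rho(f)=\{i\mid f_i=c_i,\ f_i-f_{i+1}=2\}$, $\gamma(f)=\{i\mid f_i=d_i,\ f_i-f_{i+1}=1\}$. \item $x_{0,0}=1$, $x_{-1,0}=z^{-1}a+1-z^{-1}a^{-1}$, and $x_{0,-1}=a^{-1}$. \end{itemize}
   Context: All links are unoriented and given by planar diagrams. Inside a disk with four boundary points NW, NE, SW, SE consider four tangles: the crossing $X$, in which the strand joining NW to SE passes over the strand joining SW to NE; the switched crossing $\overline{X}$, in which the strand joining SW to NE passes over the strand joining NW to SE; the tangle $[0]$, consisting of two crossingless arcs NW--NE and SW--SE; and the tangle $[\infty]$, consisting of two crossingless arcs NW--SW and NE--SE. Dubrovnik polynomial: $P(K)=P(K)(z,a)\in\mathbb{Z}[a^{\pm1},z^{\pm1}]$ is the unique function of unoriented link diagrams $K$ such that (1) $P$ is invariant under regular isotopy (planar isotopy and Reidemeister moves II and III); (2) $P(K_X)-P(K_{\overline{X}})=z\,[P(K_{[0]})-P(K_{[\infty]})]$ whenever the four diagrams are identical outside a disk in which they are the indicated tangles; (3) $P(\text{diagram with positive curl})=a\,P(\text{diagram with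 the curl removed})$ and $P(\text{diagram with negative curl})=a^{-1}P(\text{diagram with the curl removed})$, where a curl is a Reidemeister I kink, and it is positive or negative according to the sign of its crossing (which does not depend on the orientation); (4) $P$ of the crossingless diagram of the unknot is $1$. Standard braid-form diagram $D[b_1,\dots,b_n]$ with all $b_i>0$: take four horizontal strands, at positions numbered $1,2,3,4$ from top to bottom, and close the left ends by joining position 1 to 2 and position 3 to 4. Going from left to right there are $n$ sections of twists. For $i$ odd, the $i$-th section is a horizontal row of $b_i$ crossings, each equal to $X$, between the strands in positions 2 and 3. For $i$ even, the $i$-th section is a horizontal row of $b_i$ crossings, each equal to $\overline{X}$, between the strands in positions 1 and 2. Finally close the right ends without crossings: if $n$ is odd join position 1 to 2 and 3 to 4; if $n$ is even join position 2 to 3 and position 1 to 4. These diagrams are alternating. Write $\mathcal{P}[b_1,\dots,b_n]:=P(D[b_1,\dots,b_n])$. *)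

(* Defs.v *)
From HB Require Import structures.
From Stdlib Require Import Relation_Operators.
From mathcomp Require Import all_boot all_order all_algebra.
From mathcomp Require Import boolp classical_sets fsbigop.

Set Implicit Arguments.
Unset Strict Implicit.
Unset Printing Implicit Defensive.

Import GRing.Theory.
Local Open Scope ring_scope.

(* Z[a^{+-1}, z^{+-1}] is taken inside the fraction field of Z[z][a]. *)

Definition ratfun := {fraction {poly {poly int}}}.
Definition pa : ratfun := tofrac 'X.
Definition pz : ratfun := tofrac 'X%:P.

Definition laurent (x : ratfun) : Prop :=
  exists (p : {poly {poly int}}) (m k : nat), x * pa ^+ m * pz ^+ k = tofrac p.

(* An unoriented planar link diagram in general position with respect to the  *)
(* horizontal coordinate is cut by vertical lines into elementary slices,     *)
(* listed from left to right.  A slice (e, i) is the elementary tangle e with *)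
(* i straight horizontal strands above it (and any number of strands below).  *)
(*   Cup   is the arc opening to the right: it creates two adjacent strands;  *)
(*   Cap   is the arc opening to the left: it joins two adjacent strands;     *)
(*   Xover is the crossing whose NW-SE strand passes over;                    *)
(*   Xunder is the crossing whose SW-NE strand passes over.                   *)

Variant elementary := Cup | Cap | Crossing of bool.
Notation Xover := (Crossing true).
Notation Xunder := (Crossing false).

Definition slice : Type := elementary * nat.

Definition src (e : elementary) : nat := if e is Cup then 0 else 2.
Definition tgt (e : elementary) : nat := if e is Cap then 0 else 2.

(* Number of strands to the right of a word, given the number to its left;    *)
(* None when some slice does not fit.                                         *)
Fixpoint strands (m : nat) (w : seq slice) : option nat :=
  if w is (e, i) :: w' then
    if (i + src e <= m)%N then strands (m - src e + tgt e)%N w' else None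
  else Some m.

Definition closed_word (w : seq slice) : bool :=
  (0 < size w)%N && (strands 0 w == Some 0%N).

Record diagram := Diagram {
  slices :> seq slice;
  _ : closed_word slices }.

(* The constructors before Rmove2 generate planar isotopy: exchanging two     *)
(* slices that act on disjoint sets of strands, straightening a zigzag, and   *)
(* sliding a strand across the extremum of another strand passing over or     *)
(* under it (this turns the crossing by a right angle, hence exchanges Xover  *)
(* and Xunder). In Rmove3 the side condition says that the three strands lie  *)
(* at three distinct heights.                                                 *)
Inductive local_move : seq slice -> seq slice -> Prop :=
| Exchange (e e' : elementary) (i k : nat) :
    local_move [:: (e, i); (e', i + tgt e + k)%N]
               [:: (e', i + src e + k)%N; (e, i)]
| ZigzagDown (i : nat) : local_move [:: (Cup, i); (Cap, i.+1)] [::]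
| ZigzagUp (i : nat) : local_move [:: (Cup, i.+1); (Cap, i)] [::]
| SlideCup (o : bool) (i : nat) :
    local_move [:: (Cup, i); (Crossing o, i.+1)]
               [:: (Cup, i.+1); (Crossing (~~ o), i)]
| SlideCap (o : bool) (i : nat) :
    local_move [:: (Crossing o, i); (Cap, i.+1)]
               [:: (Crossing (~~ o), i.+1); (Cap, i)]
| Rmove2 (o : bool) (i : nat) :
    local_move [:: (Crossing o, i); (Crossing (~~ o), i)] [::]
| Rmove3 (o1 o2 o3 : bool) (i : nat) :
    (o1 == o2) || (o2 == o3) ->
    local_move [:: (Crossing o1, i); (Crossing o2, i.+1); (Crossing o3, i)]
               [:: (Crossing o3, i.+1); (Crossing o2, i); (Crossing o1, i.+1)].

Definition elementary_move (D D' : diagram) : Prop :=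
  exists u v l r : seq slice,
    [/\ local_move l r, slices D = u ++ l ++ v & slices D' = u ++ r ++ v].

Definition regular_isotopic : diagram -> diagram -> Prop :=
  clos_refl_sym_trans diagram elementary_move.

(* [curl s k l]: k is a kink of sign s (true: positive) and l is the same     *)
(* strand without it. Going once around the loop of Cup followed by Xover,    *)
(* one travels along SE-directed over and SW-directed under strands (or both  *)
(* reversed), so this crossing is negative; with Xunder it is positive, and   *)
(* likewise for Cap. Planar isotopy turns any kink into these positions.      *)
Inductive curl : bool -> seq slice -> seq slice -> Prop :=
| CurlCup (o : bool) (i : nat) :
    curl (~~ o) [:: (Cup, i); (Crossing o, i)] [:: (Cup, i)]
| CurlCap (o : bool) (i : nat) :
    curl (~~ o) [:: (Crossing o, i); (Cap, i)] [:: (Cap, i)].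

Definition unknot : diagram :=
  @Diagram [:: (Cup, 0%N); (Cap, 0%N)] isT.

(* Every disk of a diagram containing a single crossing can be brought to the *)
(* position of an Xover slice by planar isotopy; [0] is then the empty word   *)
(* and [infinity] is Cap followed by Cup.                                     *)
Record dubrovnik (P : diagram -> ratfun) : Prop := {
  dub_laurent : forall D : diagram, laurent (P D);
  dub_isotopy : forall D D' : diagram, regular_isotopic D D' -> P D = P D';
  dub_skein : forall (u v : seq slice) (i : nat) (DX DXbar D0 Doo : diagram),
    slices DX = u ++ [:: (Xover, i)] ++ v ->
    slices DXbar = u ++ [:: (Xunder, i)] ++ v ->
    slices D0 = u ++ v ->
    slices Doo = u ++ [:: (Cap, i); (Cup, i)] ++ v ->
    P DX - P DXbar = pz * (P D0 - P Doo);
  dub_pos_curl : forall (u v k l : seq slice) (D D' : diagram),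
    curl true k l ->
    slices D = u ++ k ++ v -> slices D' = u ++ l ++ v ->
    P D = pa * P D';
  dub_neg_curl : forall (u v k l : seq slice) (D D' : diagram),
    curl false k l ->
    slices D = u ++ k ++ v -> slices D' = u ++ l ++ v ->
    P D = pa^-1 * P D';
  dub_unknot : P unknot = 1 }.

Definition twist_section (i m : nat) : seq slice :=
  nseq m (if odd i then (Xover, 1%N) else (Xunder, 0%N)).

Definition standard_word (b : seq nat) : seq slice :=
  [:: (Cup, 0%N); (Cup, 2%N)] ++
  flatten [seq twist_section i (nth 0%N b i.-1) | i <- iota 1 (size b)] ++
  (if odd (size b) then [:: (Cap, 0%N); (Cap, 0%N)]
                   else [:: (Cap, 1%N); (Cap, 0%N)]).

Lemma standard_word_closed (b : seq nat) : closed_word (standard_word b).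
Proof.
rewrite /closed_word /standard_word /=.
set e := (if odd (size b) then _ else _).
have -> : forall s, strands 4 (flatten
    [seq twist_section i (nth 0%N b i.-1) | i <- s] ++ e) = strands 4 e.
  elim=> //= i s IH; rewrite -catA /twist_section.
  elim: (nth 0%N b i.-1) => [|m IHm] //=.
  by case: (odd i) IHm.
by rewrite /e; case: (odd _).
Qed.

Definition standard_diagram (b : seq nat) : diagram :=
  Diagram (standard_word_closed b).

Variant label := Lc | Ld.
Definition label_code (x : label) : bool := if x is Ld then true else false.
Definition label_decode (x : bool) : label := if x then Ld else Lc.
Lemma label_codeK : cancel label_code label_decode. Proof. by case. Qed.
HB.instance Definition _ := Countable.copy label (can_type label_codeK).

(* f = (s, e): s lists the labelled terms f_1, ..., f_{l-1}; e is the final   *)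
(* term f_l, which carries no label. Indices are 1-based.                     *)
Definition lseq : Type := (seq (int * label) * int)%type.

Definition terms (f : lseq) : seq int := rcons (map fst f.1) f.2.
Definition len (f : lseq) : nat := size (terms f).
Definition term (f : lseq) (i : nat) : int := nth 0 (terms f) i.-1.
Definition lab (f : lseq) (i : nat) : label := nth Lc (map snd f.1) i.-1.
Definition drop_by (f : lseq) (i : nat) : int := term f i - term f i.+1.

Definition Fset (n : nat) : set lseq := [set f : lseq |
  [/\ term f 1 = n%:Z,
      (forall i : nat, (1 <= i < len f)%N ->
         (drop_by f i = 1) \/ (drop_by f i = 2)),
      (term f (len f) = 0) \/ (term f (len f) = -1),
      ~~ ((0 \in terms f) && (-1 \in terms f)) &
      (forall i : nat, (1 <= i < len f)%N -> lab f i = Ld ->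
         drop_by f i = 1)]]%classic.

Definition in_lambda (f : lseq) (i : nat) : bool :=
  (lab f i == Lc) && (drop_by f i == 1).
Definition in_rho (f : lseq) (i : nat) : bool :=
  (lab f i == Lc) && (drop_by f i == 2).
Definition in_gamma (f : lseq) (i : nat) : bool :=
  (lab f i == Ld) && (drop_by f i == 1).

(* b_m, with b_0 = b_{-1} = 0 *)
Definition entry (b : seq nat) (m : int) : nat :=
  if m is Posz k.+1 then nth 0%N b k else 0%N.

Definition tcorr (f : lseq) (i : nat) : nat :=
  ((1 < i)%N && (lab f i.-1 == Ld)).

Definition beta (b : seq nat) (f : lseq) (i : nat) : int :=
  (entry b (term f i))%:Z - (tcorr f i)%:Z.

Definition sgn (f : lseq) (i : nat) : int := (-1) ^ (term f i - 1).

Definition xfin (m k : int) : ratfun :=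
  if (m == 0) && (k == 0) then 1
  else if (m == -1) && (k == 0) then pz^-1 * pa + 1 - pz^-1 * pa^-1
  else if (m == 0) && (k == -1) then pa^-1
  else 0.

(* In the three weights s is the sign and t the (nonnegative) value beta_i of *)
(* a non-final index i.  The number of terms of the sum in [weightG] is       *)
(* floor((t-1)/2) + 1 = floor((t+1)/2), which is 0 for t = 0.                 *)
Definition weightL (s : int) (t : nat) : ratfun :=
  - \sum_(1 <= j < t.+1) \sum_(0 <= k < (j.-1)./2.+1)
      (s%:~R * pz) ^+ (j - 2 * k) * pa ^ (s * (j%:Z - t%:Z))
        * 'C(j - 1 - k, k)%:R.

Definition weightR (s : int) (bprev t : nat) : ratfun :=
  pa ^ (s * bprev%:Z) *
  \sum_(0 <= k < t./2.+1) (s%:~R * pz) ^+ (t - 2 * k) * 'C(t - k, k)%:R.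

Definition weightG (s : int) (t : nat) : ratfun :=
  \sum_(0 <= k < (t.+1)./2)
      (s%:~R * pz) ^+ (t - 1 - 2 * k) * 'C(t - 1 - k, k)%:R.

Definition Lambda (b : seq nat) (f : lseq) (i : nat) : ratfun :=
  weightL (sgn f i) `|beta b f i|%N.
Definition Rho (b : seq nat) (f : lseq) (i : nat) : ratfun :=
  weightR (sgn f i) (entry b (term f i - 1)) `|beta b f i|%N.
Definition Gamma (b : seq nat) (f : lseq) (i : nat) : ratfun :=
  weightG (sgn f i) `|beta b f i|%N.

(* Main.v *)
(* Resolving the crossings of the last section one at a time, with
   Reidemeister II and removal of curls, gives for q_m, the polynomial of the
   diagram whose last section has m crossings, the recurrence
     q_(m+2) = q_m + s z (q_(m+1) - a^(-s (m+1)) v),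
   where s is the sign of the section and v the polynomial of the diagram
   without it.  Its solution, with Fibonacci polynomials in s z as coefficients,
   expresses P[b_1, .., b_n] through P[b_1, .., b_(n-1)] (weight Lambda),
   q_(-1) = P[b_1, .., b_(n-1) - 1] (weight Gamma) and
   q_0 = a^(s b_(n-1)) P[b_1, .., b_(n-2)] (weight R).  Unfolding this
   recursion down to the indices 0 and -1 yields one summand for each labelled
   sequence in F. *)
Require Import Defs.
From Stdlib Require Import Relation_Operators.
From mathcomp Require Import all_boot all_order all_algebra ring zify.
From mathcomp Require Import boolp classical_sets fsbigop.
Import GRing.Theory.
Local Open Scope ring_scope.

(** * Fibonacci polynomials and the recurrence for one section *)

(** The Fibonacci polynomial with shifted index, [F_(m+1)(x)], in closed form. *)
Definition fibpoly (R : pzSemiRingType) (x : R) (m : nat) : R :=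
  \sum_(0 <= k < m./2.+1) x ^+ (m - 2 * k) * 'C(m - k, k)%:R.

(** For [k > m/2] the binomial vanishes, so the truncated exponent is harmless; sums for different
    [m] can thus share one range. *)
Lemma fibpoly_widen (R : pzSemiRingType) (x : R) (m N : nat) : (m < N)%N ->
  fibpoly R x m = \sum_(0 <= k < N) x ^+ (m - 2 * k) * 'C(m - k, k)%:R.
Proof.
move=> mN; rewrite (@big_cat_nat _ _ _ m./2.+1 0 N) //=; last by lia.
rewrite [X in _ + X]big1_seq ?addr0 // => k.
rewrite mem_index_iota => /andP[_ /andP[lek _]].
by rewrite bin_small ?mulr0 //; lia.
Qed.

Lemma fibpoly0 (R : pzSemiRingType) (x : R) : fibpoly R x 0 = 1.
Proof. by rewrite /fibpoly big_nat1 mulr1. Qed.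

Lemma fibpoly1 (R : pzSemiRingType) (x : R) : fibpoly R x 1 = x.
Proof. by rewrite /fibpoly big_nat1 mulr1. Qed.

(** Pascal's rule, applied termwise once the ranges are aligned. *)
Lemma fibpolySS (R : pzSemiRingType) (x : R) (m : nat) :
  fibpoly R x m.+2 = x * fibpoly R x m.+1 + fibpoly R x m.
Proof.
rewrite (fibpoly_widen R x m.+2 m.+3) // (fibpoly_widen R x m.+1 m.+3) //.
rewrite (fibpoly_widen R x m m.+2) // !(big_nat_recl m.+2) //=.
rewrite !muln0 !subn0 !bin0 !mulr1 mulrDr -exprS -addrA; congr (_ + _).
rewrite big_distrr -big_split; apply: eq_bigr => k _ /=.
have -> : (m.+2 - 2 * k.+1 = m - 2 * k)%N by lia.
rewrite (subSS k m.+1) (subSS k m) mulrA -exprS.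
have [lekm|ltmk] := leqP k m; last by rewrite !bin_small ?mulr0 ?addr0 //; lia.
rewrite subSn // binS natrD mulrDr; congr (_ + _).
(* The truncated exponents agree only when [k < m - k]; otherwise the binomial is 0. *)
have [small|big] := ltnP (m - k) k.+1; first by rewrite !bin_small // !mulr0.
by congr (x ^+ _ * _); lia.
Qed.

Lemma weightR_fibpoly (s : int) (b t : nat) :
  weightR s b t = pa ^ (s * b%:Z) * fibpoly ratfun (s%:~R * pz) t.
Proof. by []. Qed.

Lemma weightG0 (s : int) : weightG s 0 = 0.
Proof. by rewrite /weightG big_geq. Qed.

Lemma weightGS (s : int) (t : nat) :
  weightG s t.+1 = fibpoly ratfun (s%:~R * pz) t.
Proof. by rewrite /weightG subSS subn0. Qed.

(** The inner sum at [j] is [s z] times a Fibonacci polynomial of index [j - 1], so the weight is a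
    convolution with powers of [a^(-s)]. *)
Lemma weightLE (s : int) (t : nat) :
  weightL s t = - \sum_(j < t) s%:~R * pz * fibpoly ratfun (s%:~R * pz) j
                                 * (pa ^ (- s)) ^+ (t.-1 - j).
Proof.
rewrite /weightL big_add1 big_mkord; congr (- _); apply: eq_bigr => -[j ltjt] _ /=.
rewrite big_distrr big_distrl /=; apply: eq_big_nat => k ltk.
rewrite subSS subn0 mulrA -exprS -subSn; last by lia.
rewrite mulrAC; congr (_ * _ * _).
rewrite exprnP exprz_exp; congr (_ ^ _).
by rewrite mulNr -mulrN; congr (_ * _); lia.
Qed.

Lemma weightLSS (s : int) (t : nat) :
  weightL s t.+2 = s%:~R * pz * (weightL s t.+1 - (pa ^ (- s)) ^+ t.+1)
                   + weightL s t.
Proof.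
rewrite !weightLE !big_ord_recl /= !subn0.
rewrite fibpoly0 /bump /= !add1n fibpoly1 !subSS !subn0.
set x := s%:~R * pz; set c := pa ^ (- s).
have -> : \sum_(i < t) x * fibpoly ratfun x (1 + (1 + i))
                          * c ^+ (t.+1 - (1 + (1 + i))) =
    x * \sum_(i < t) x * fibpoly ratfun x (1 + i) * c ^+ (t - (1 + i))
    + \sum_(i < t) x * fibpoly ratfun x i * c ^+ (t.-1 - i).
  rewrite big_distrr -big_split; apply: eq_bigr => i _ /=.
  rewrite !add1n fibpolySS.
  have -> : (t.+1 - i.+2 = t.-1 - i)%N by lia.
  have -> : (t - i.+1 = t.-1 - i)%N by lia.
  by ring.
by rewrite exprS; ring.
Qed.

(** The first hypothesis is the recurrence at [m = -1], with [q'] as [q_(-1)]. [fibpoly] and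
    [weightG] solve the homogeneous equation; [weightL] carries the inhomogeneous term and vanishes
    at 0. The induction keeps two consecutive values. *)
Lemma section_recurrence (s : int) (v q' : ratfun) (q : nat -> ratfun) :
  q 1%N = q' + s%:~R * pz * (q 0%N - v) ->
  (forall m, q m.+2 = q m + s%:~R * pz * (q m.+1 - (pa ^ (- s)) ^+ m.+1 * v)) ->
  forall m, q m = weightL s m * v + fibpoly ratfun (s%:~R * pz) m * q 0%N
                  + weightG s m * q'.
Proof.
move=> q1 qSS m.
suff: q m = weightL s m * v + fibpoly ratfun (s%:~R * pz) m * q 0%N
            + weightG s m * q' /\
  q m.+1 = weightL s m.+1 * v + fibpoly ratfun (s%:~R * pz) m.+1 * q 0%N
            + weightG s m.+1 * q' by case.
elim: m => [|m [IH1 IH2]].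
  rewrite q1 !weightLE big_ord0 big_ord1 weightG0 weightGS fibpoly0 fibpoly1.
  by rewrite expr0; split; ring.
split=> //; rewrite qSS IH1 IH2 weightLSS !weightGS fibpolySS.
case: m {IH1 IH2} => [|m]; last by rewrite weightGS fibpolySS; ring.
by rewrite weightG0 fibpoly1 fibpoly0; ring.
Qed.

(** * Local moves on the last section and its closing *)

(* Extended by 0 to words that are not closed. *)
Definition word_poly (P : diagram -> ratfun) (w : seq slice) : ratfun :=
  if insub w is Some w' then P (Diagram (valP (w' : {w | closed_word w}))) else 0.

Lemma word_polyE (P : diagram -> ratfun) (D : diagram) :
  word_poly P D = P D.
Proof.
case: D => w cw; rewrite /word_poly /= insubT /=.
by congr (P (Diagram _)); apply: bool_irrelevance.
Qed.

Lemma strands_cat (m : nat) (u v : seq slice) :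
  strands m (u ++ v) = obind (strands^~ v) (strands m u).
Proof. by elim: u m => [|[e i] u IH] m //=; case: ifP. Qed.

Lemma closed_cat (u v : seq slice) (m : nat) :
  strands 0 u = Some m -> (0 < m)%N -> strands m v = Some 0%N ->
  closed_word (u ++ v).
Proof.
case: u => [|x u] um m0 vm; first by case: um m0 => <-.
by rewrite /closed_word strands_cat um /= vm.
Qed.

Section Dubrovnik.
Context {P : diagram -> ratfun} (hP : dubrovnik P).
Local Notation Pw := (word_poly P).

Lemma word_poly_move (u v l r : seq slice) :
  local_move l r -> closed_word (u ++ l ++ v) -> closed_word (u ++ r ++ v) ->
  Pw (u ++ l ++ v) = Pw (u ++ r ++ v).
Proof.
move=> lr cl cr.
rewrite (word_polyE P (Diagram cl)) (word_polyE P (Diagram cr)).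
by apply: (dub_isotopy hP); apply: rst_step; exists u, v, l, r.
Qed.

Lemma word_poly_curl (s : bool) (u v k l : seq slice) :
  curl s k l -> closed_word (u ++ k ++ v) -> closed_word (u ++ l ++ v) ->
  Pw (u ++ k ++ v) = pa ^ (if s then 1 else -1) * Pw (u ++ l ++ v).
Proof.
move=> kl ck cl.
rewrite (word_polyE P (Diagram ck)) (word_polyE P (Diagram cl)).
by case: s kl => kl; [apply: (dub_pos_curl hP)|apply: (dub_neg_curl hP)]; eauto.
Qed.

(* p is the parity of a section (true: odd); it is also the height of its
   crossings, read as a natural number. *)
Definition crossing (p : bool) : slice := (Crossing p, nat_of_bool p).
Definition switched (p : bool) : slice := (Crossing (~~ p), nat_of_bool p).
Definition closing (p : bool) : seq slice :=
  if p then [:: (Cap, 0%N); (Cap, 0%N)] else [:: (Cap, 1%N); (Cap, 0%N)].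
Definition closing_poly (p : bool) (u : seq slice) : ratfun :=
  Pw (u ++ closing p).
Definition parity_sign (p : bool) : int := if p then 1 else -1.

(** Under the closing of the opposite parity, the last crossing and a cap form a kink. *)
Lemma closing_poly_curl (p : bool) (u : seq slice) : strands 0 u = Some 4%N ->
  closing_poly (~~ p) (u ++ [:: crossing p])
  = pa ^ (- parity_sign p) * closing_poly (~~ p) u.
Proof.
rewrite /closing_poly -catA => u4; case: p.
- by apply: (word_poly_curl false u [:: (Cap, 0%N)] _ _ (CurlCap true 1));
    apply: closed_cat u4 _ _.
- rewrite opprK; apply: (word_poly_curl true u [:: (Cap, 0%N)] _ _ (CurlCap false 0));
    exact: closed_cat u4 _ _.
Qed.

(** Sliding a strand across the cap turns the crossing by a right angle. The result can then cancel
    a crossing of the preceding section. *)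
Lemma closing_poly_slide (p : bool) (u : seq slice) : strands 0 u = Some 4%N ->
  closing_poly p (u ++ [:: switched p])
  = closing_poly (~~ p) (u ++ [:: switched (~~ p)]).
Proof.
rewrite /closing_poly -!catA => u4.
wlog -> : p / p = false => [slide|].
  by case: p; [symmetry; apply: (slide false)|apply: slide].
by apply: (word_poly_move u [:: (Cap, 0%N)] _ _ (SlideCap true 0));
  apply: closed_cat u4 _ _.
Qed.

Lemma closing_poly_Rmove2 (p : bool) (u : seq slice) : strands 0 u = Some 4%N ->
  closing_poly p ((u ++ [:: crossing p]) ++ [:: switched p]) = closing_poly p u.
Proof.
rewrite /closing_poly -!catA => u4.
by apply: (word_poly_move u (closing p) _ [::] (Rmove2 p p));
  apply: closed_cat u4 _ _ => //; case: p.
Qed.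

(** In the [infinity] smoothing, the new cup and a cap of the closing straighten, leaving the other
    closing. *)
Lemma closing_poly_zigzag (p : bool) (u : seq slice) : strands 0 u = Some 4%N ->
  closing_poly p (u ++ [:: (Cap, nat_of_bool p); (Cup, nat_of_bool p)])
  = closing_poly (~~ p) u.
Proof.
rewrite /closing_poly -!catA => u4; case: p.
- have := word_poly_move (u ++ [:: (Cap, 1%N)]) [:: (Cap, 0%N)] _ _ (ZigzagUp 0).
  by rewrite -!catA; apply; apply: closed_cat u4 _ _.
- have := word_poly_move (u ++ [:: (Cap, 0%N)]) [:: (Cap, 0%N)] _ _ (ZigzagDown 0).
  by rewrite -!catA; apply; apply: closed_cat u4 _ _.
Qed.

(** Even sections consist of [Xunder], so there the skein relation is read backwards; this is the
    source of the sign. *)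
Lemma closing_poly_skein (p : bool) (u : seq slice) : strands 0 u = Some 4%N ->
  closing_poly p (u ++ [:: crossing p])
  = closing_poly p (u ++ [:: switched p])
    + (parity_sign p)%:~R * pz * (closing_poly p u - closing_poly (~~ p) u).
Proof.
move=> u4; rewrite -closing_poly_zigzag //.
have cl v : strands 4 v = Some 4%N -> closed_word ((u ++ v) ++ closing p).
  move=> v4; rewrite -catA; apply: closed_cat u4 _ _ => //.
  by rewrite strands_cat v4; case: (p).
have c0 : closed_word (u ++ closing p) by apply: closed_cat u4 _ _; case: (p).
have c1 (o : bool) : closed_word ((u ++ [:: (Crossing o, nat_of_bool p)]) ++ closing p).
  by apply: cl; case: (p).
have c2 : closed_word
    ((u ++ [:: (Cap, nat_of_bool p); (Cup, nat_of_bool p)]) ++ closing p).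
  by apply: cl; case: (p).
have := @dub_skein _ hP u (closing p) p (Diagram (c1 true)) (Diagram (c1 false))
  (Diagram c0) (Diagram c2).
move=> /(_ (esym (catA _ _ _)) (esym (catA _ _ _)) erefl (esym (catA _ _ _))).
rewrite -!word_polyE /= /closing_poly /crossing /switched.
case: (p) => /= E.
  by rewrite mul1r -E; ring.
by rewrite mulN1r mulNr -E; ring.
Qed.

Lemma strands_catl (u v : seq slice) : strands 0 u = Some 4%N ->
  strands 4 v = Some 4%N -> strands 0 (u ++ v) = Some 4%N.
Proof. by move=> u4 v4; rewrite strands_cat u4. Qed.

Lemma strands_twists (p : bool) (m : nat) :
  strands 4 (nseq m (crossing p)) = Some 4%N.
Proof. by case: p; elim: m. Qed.

Lemma closing_poly_curls (p : bool) (u : seq slice) (m : nat) :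
  strands 0 u = Some 4%N ->
  closing_poly (~~ p) (u ++ nseq m (crossing p))
  = (pa ^ (- parity_sign p)) ^+ m * closing_poly (~~ p) u.
Proof.
move=> u4; elim: m => [|m IH]; first by rewrite cats0 mul1r.
rewrite -addn1 nseqD catA closing_poly_curl; last first.
  exact/strands_catl/strands_twists.
by rewrite IH addn1 exprS mulrA.
Qed.

Lemma closing_poly_section (p : bool) (u : seq slice) (m : nat) :
  strands 0 u = Some 4%N ->
  let s := parity_sign p in
  closing_poly p (u ++ nseq m (crossing p)) =
    weightL s m * closing_poly (~~ p) u
    + fibpoly ratfun (s%:~R * pz) m * closing_poly p u
    + weightG s m * closing_poly p (u ++ [:: switched p]).
Proof.
move=> u4 s.
have u4' k : strands 0 (u ++ nseq k (crossing p)) = Some 4%N.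
  exact/strands_catl/strands_twists.
have := section_recurrence s (closing_poly (~~ p) u)
  (closing_poly p (u ++ [:: switched p]))
  (fun m => closing_poly p (u ++ nseq m (crossing p))).
cbv beta; rewrite [nseq 0 _]/= cats0; apply=> [|k].
  by rewrite closing_poly_skein.
have E j : nseq j.+1 (crossing p) = nseq j (crossing p) ++ [:: crossing p].
  by rewrite -addn1 nseqD.
rewrite (E k.+1) catA closing_poly_skein // closing_poly_curls //.
by rewrite E catA closing_poly_Rmove2.
Qed.

Definition opening : seq slice := [:: (Cup, 0%N); (Cup, 2%N)].

Lemma closing_poly_opening_false : closing_poly false opening = 1.
Proof.
rewrite -(dub_unknot hP) -word_polyE.
exact: (word_poly_move [:: (Cup, 0%N)] [:: (Cap, 0%N)] _ _ (ZigzagUp 1)).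
Qed.

Lemma closing_poly_opening_curl (o : bool) :
  closing_poly false (opening ++ [:: (Crossing o, 0%N)])
  = pa ^ (- parity_sign o).
Proof.
(* Moving the crossing to the left of the second cup makes it a kink on the first one. *)
have := word_poly_move [:: (Cup, 0%N)] (closing false) _ _
          (Exchange (Crossing o) Cup 0 0) isT isT.
rewrite /closing_poly /= => <-.
have := word_poly_curl (~~ o) [::] [:: (Cup, 2%N), (Cap, 1%N) & [:: (Cap, 0%N)]] _ _
          (CurlCup o 0) isT isT.
rewrite /= => ->.
by rewrite -/(closing_poly false opening) closing_poly_opening_false mulr1; case: o.
Qed.

Lemma pz_neq0 : pz != 0.
Proof. by rewrite tofrac_eq0 polyC_eq0 polyX_eq0. Qed.

(** The two-component unlink: in the skein relation for one crossing, both crossing diagrams are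
    kinked unknots, with values [a] and [a^-1], and one solves for the remaining smoothing. *)
Lemma closing_poly_opening_true :
  closing_poly true opening = pz^-1 * pa + 1 - pz^-1 * pa^-1.
Proof.
have := closing_poly_skein false opening erefl.
rewrite !closing_poly_opening_curl closing_poly_opening_false.
rewrite /= mulN1r opprK exprN1 expr1z => E; apply: (mulfI pz_neq0).
rewrite !mulrBr !mulrDr !mulrA divff ?pz_neq0 // mul1r mulr1.
rewrite mul1r addrAC [X in X - _ + _]E.
by ring.
Qed.

End Dubrovnik.

(** * Diagrams built section by section *)

Fixpoint sections (b : seq nat) (k : nat) : seq slice :=
  if k is k'.+1
  then sections b k' ++ nseq (nth 0%N b k') (crossing (odd k))
  else opening.

Lemma strands_sections (b : seq nat) (k : nat) :
  strands 0 (sections b k) = Some 4%N.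
Proof. by elim: k => //= k IH; apply: strands_catl IH (strands_twists _ _). Qed.

Lemma standard_wordE (b : seq nat) :
  standard_word b = sections b (size b) ++ closing (odd (size b)).
Proof.
rewrite /standard_word catA; congr (_ ++ _).
rewrite -/opening; elim: (size b) => [|k IH] //.
have -> : iota 1 k.+1 = iota 1 k ++ [:: k.+1] by rewrite -(addn1 k) iotaD /= add1n addn1.
rewrite map_cat flatten_cat catA IH /= cats0.
by rewrite /twist_section /=; congr (_ ++ nseq _ _); case: (odd k).
Qed.

(* The polynomial of the diagram with sections 1, .., k - 1 and t crossings
   removed from the last one.  The values at k = 0 and k = 1 are x_(-1,0),
   x_(0,0) and x_(0,-1), and make partial_polySS hold for all k. *)
Definition partial_poly (P : diagram -> ratfun) (b : seq nat)
    (k : nat) (t : bool) : ratfun :=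
  match k with
  | 0 => pz^-1 * pa + 1 - pz^-1 * pa^-1
  | 1 => if t then pa^-1 else 1
  | k.+2 => @closing_poly P (odd k.+1)
      (sections b k ++ nseq (nth 0%N b k - t) (crossing (odd k.+1)))
  end.

(** Of the three terms of [closing_poly_section], the second untwists the preceding section into
    kinks, and the third cancels one of its crossings. *)
Lemma partial_polySS (P : diagram -> ratfun) (hP : dubrovnik P)
    (b : seq nat) (k : nat) (t : bool) :
  (forall i, (i < k)%N -> (0 < nth 0%N b i)%N) ->
  let s := parity_sign (odd k.+1) in
  let m := (nth 0%N b k - t)%N in
  partial_poly P b k.+2 t =
    weightL s m * partial_poly P b k.+1 false
    + weightR s (entry b k) m * partial_poly P b k false
    + weightG s m * partial_poly P b k.+1 true.
Proof.
move=> bpos s m.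
rewrite {1}/partial_poly closing_poly_section ?strands_sections //.
rewrite weightR_fibpoly -/s -/m.
congr (_ * _ + _ + _ * _).
- case: k {s m} bpos => [|k] _; first by rewrite closing_poly_opening_false.
  by rewrite /partial_poly subn0 -[odd k.+2]/(~~ odd k.+1) negbK.
- rewrite -mulrA mulrCA; congr (_ * _).
  case: k @s {m} bpos => [|k] s _.
    by rewrite /= mulr0 expr0z mul1r closing_poly_opening_true.
  rewrite /= in s *.
  rewrite -/(odd k.+1) closing_poly_curls ?strands_sections //.
  rewrite exprnP exprz_exp; congr (pa ^ _ * _).
    (* Consecutive sections have opposite signs, so the kink factor has exponent [s * b]. *)
    by rewrite /s /=; case: (odd k); rewrite ?opprK.
  case: k s => [|k] s; first by rewrite /= closing_poly_opening_false.
  by rewrite /partial_poly /= !negbK subn0.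
- rewrite closing_poly_slide ?strands_sections //.
  case: k {s m} bpos => [|k] bpos.
    by rewrite closing_poly_opening_curl ?exprN1.
  rewrite -[odd k.+2]/(~~ odd k.+1) negbK /=.
  (* Positivity supplies the crossing that cancels the slid one. *)
  have := bpos k (ltnSn k); case E: (nth 0%N b k) => [//|c] _.
  rewrite -addn1 nseqD addnK catA closing_poly_Rmove2 //.
  exact: strands_catl (strands_sections _ _) (strands_twists _ _).
Qed.

(** * Enumeration of the labelled sequences *)

Definition first_term (s : seq (int * label)) (e : int) : int :=
  head e [seq x.1 | x <- s].

(** Only the local conditions fit this recursion; the exclusion of 0 and -1 together is global and
    stays separate. *)
Fixpoint chain (s : seq (int * label)) (e : int) : bool :=
  if s is (m, l) :: s' then
    let d := m - first_term s' e in
    ((d == 1) || (d == 2) && (l == Lc)) && chain s' e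
  else (e == 0) || (e == -1).

Lemma chainP (f : lseq) :
  [/\ forall i : nat, (1 <= i < len f)%N -> (drop_by f i = 1) \/ (drop_by f i = 2),
      (term f (len f) = 0) \/ (term f (len f) = -1) &
      forall i : nat, (1 <= i < len f)%N -> lab f i = Ld -> drop_by f i = 1]
  <-> chain f.1 f.2.
Proof.
case: f => s e; elim: s => [|[m l] s IH] /=.
  split=> [[_ []]|/orP[]] /=; rewrite /term /= => /eqP -> //; rewrite ?orbT //.
    by split; [case=> [|[]]|left|case=> [|[]]].
  by split; [case=> [|[]]|right|case=> [|[]]].
have hd : drop_by ((m, l) :: s, e) 1 = m - first_term s e.
  by rewrite /drop_by /term; case: (s).
have tl i : drop_by ((m, l) :: s, e) i.+2 = drop_by (s, e) i.+1 by [].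
have len1 : (0 < len (s, e))%N by rewrite /len /terms size_rcons.
have lst : term ((m, l) :: s, e) (len ((m, l) :: s, e)) = term (s, e) (len (s, e)).
  by rewrite /term /len /terms /= !size_rcons.
split=> [[H1 H2 H3]|/andP[hm /IH[H1 H2 H3]]].
  apply/andP; split.
    have := H1 1%N len1; have := H3 1%N len1; rewrite hd.
    case: (l) => /= H [] E; rewrite ?E ?eqxx //=.
    by have := H erefl; rewrite E.
  apply/IH; split=> [i||i].
  - by case: i => // i ilt; rewrite -tl; apply: H1.
  - by rewrite -lst.
  - by case: i => // i ilt; rewrite -tl; apply: (H3 i.+2).
split=> [i||i].
- case: i => // -[|i] // ilt; last exact: (H1 i.+1 ilt).
  by rewrite hd; case/orP: hm => [/eqP|/andP[/eqP]]; [left|right].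
- by rewrite lst.
- case: i => // -[|i] // ilt; last exact: (H3 i.+1 ilt).
  rewrite hd /lab /= => E; move: hm; rewrite E.
  by rewrite andbF orbF => /eqP.
Qed.

Lemma chain_ge (s : seq (int * label)) (e : int) : chain s e -> -1 <= first_term s e.
Proof.
elim: s => [|[m l] s IH] /=; first by rewrite /first_term /= => /orP[] /eqP ->.
by rewrite [X in _ -> _ <= X]/first_term /= => /andP[/orP[/eqP H|/andP[/eqP H _]] /IH]; lia.
Qed.

Lemma first_term_in (s : seq (int * label)) (e : int) :
  first_term s e \in terms (s, e).
Proof. by case: s => [|[m l] s]; rewrite /terms /= mem_head. Qed.

Lemma Fset_chain (n : nat) (f : lseq) :
  Fset n f <-> [/\ first_term f.1 f.2 = n%:Z, chain f.1 f.2 &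
                  ~~ ((0 \in terms f) && (-1 \in terms f))].
Proof.
have -> : first_term f.1 f.2 = term f 1 by case: f => [[|[m l] s] e].
split=> [[H1 H2 H3 H4 H5]|[H1 /chainP[H2 H3 H5] H4]]; last by split.
by split=> //; apply/chainP.
Qed.

Definition lcons (x : int * label) (f : lseq) : lseq := (x :: f.1, f.2).

(* The elements of F with first term k - 1. *)
Fixpoint Fseq (k : nat) : seq lseq :=
  match k with
  | 0 => [:: ([::], -1)]
  | k'.+1 =>
    match k' with
    | 0 => [:: ([::], 0)]
    | k''.+1 => map (lcons (k'%:Z, Lc)) (Fseq k') ++ map (lcons (k'%:Z, Ld)) (Fseq k')
                ++ map (lcons (k'%:Z, Lc)) (Fseq k'')
    end
  end.

Lemma FseqSS (k : nat) :
  Fseq k.+2 = map (lcons (k.+1%:Z, Lc)) (Fseq k.+1)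
           ++ map (lcons (k.+1%:Z, Ld)) (Fseq k.+1)
           ++ map (lcons (k.+1%:Z, Lc)) (Fseq k).
Proof. by []. Qed.

Lemma nat_ind2 (A : nat -> Prop) :
  A 0%N -> A 1%N -> (forall k, A k -> A k.+1 -> A k.+2) -> forall k, A k.
Proof. by move=> A0 A1 AS k; suff [] : A k /\ A k.+1 by []; elim: k => [|k []]; auto. Qed.

Lemma FseqP (k : nat) (f : lseq) :
  f \in Fseq k <-> [/\ first_term f.1 f.2 = k%:Z - 1, chain f.1 f.2 &
                      ~~ ((0 \in terms f) && (-1 \in terms f))].
Proof.
split; last first.
  case: f => s e /= [+ + +]; elim: s k => [|[m l] s IH] k /=.
    rewrite /first_term /= => + /orP[] /eqP E; rewrite E => Ek _.
      have -> : k = 1%N by lia.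
      by rewrite inE.
    have -> : k = 0%N by lia.
    by rewrite inE.
  rewrite {1}/first_term /= => Em /andP[H ch].
  rewrite /terms /= -/(terms (s, e)) !inE => nb.
  have nb' : ~~ ((0 \in terms (s, e)) && (-1 \in terms (s, e))).
    by apply: contra nb => /andP[-> ->]; rewrite !orbT.
  have ge := chain_ge _ _ ch.
  case: k Em => [|[|k]] Em.
  (* A non-final term -1 would be followed by a term below -1, against [ge]. *)
  - lia.
  (* A non-final term 0 must be followed by -1, which is the excluded pair. *)
  - have E : first_term s e = -1 by lia.
    by move: (first_term_in s e) nb; rewrite E Em subrr eqxx => ->; rewrite orbT.
  have -> : m = k.+1%:Z by lia.
  rewrite FseqSS !mem_cat.
  case/orP: H => [/eqP d1|/andP[/eqP d2 /eqP ->]].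
    have fs : (s, e) \in Fseq k.+1 by apply: IH => //; lia.
    by case: (l); rewrite (map_f (lcons (k.+1%:Z, _)) fs) ?orbT.
  have fs : (s, e) \in Fseq k by apply: IH => //; lia.
  by rewrite (map_f (lcons (k.+1%:Z, _)) fs) !orbT.
elim/nat_ind2: k f => [f|f|k IH0 IH1 f].
- by rewrite inE => /eqP ->.
- by rewrite inE => /eqP ->.
have step l d j g : (j + d = k.+2)%N -> (d == 1%N) || (d == 2%N) && (l == Lc) ->
    [/\ first_term g.1 g.2 = j%:Z - 1, chain g.1 g.2 &
        ~~ ((0 \in terms g) && (-1 \in terms g))] ->
    [/\ first_term (lcons (k.+1%:Z, l) g).1 (lcons (k.+1%:Z, l) g).2 = k.+2%:Z - 1,
        chain (lcons (k.+1%:Z, l) g).1 (lcons (k.+1%:Z, l) g).2 &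
        ~~ ((0 \in terms (lcons (k.+1%:Z, l) g))
            && (-1 \in terms (lcons (k.+1%:Z, l) g)))].
  case: g => s e /= jd hd [ft -> nb]; split.
  - by rewrite /first_term /=; lia.
  - rewrite ft andbT; apply/orP.
    by case/orP: hd => [/eqP d1|/andP[/eqP d2 ->]]; [left|right]; rewrite ?andbT; lia.
  - by rewrite /terms /= !inE -/(terms (s, e)).
rewrite FseqSS !mem_cat => /or3P[] /mapP[g gin ->].
- by apply: (step Lc 1%N k.+1); [lia| |exact: IH1].
- by apply: (step Ld 1%N k.+1); [lia| |exact: IH1].
- by apply: (step Lc 2%N k); [lia| |exact: IH0].
Qed.

Lemma Fset_Fseq (n : nat) : Fset n = [set` Fseq n.+1]%classic.
Proof.
apply/predeqP => f; rewrite Fset_chain; apply: iff_sym.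
have := FseqP n.+1 f; have -> // : n.+1%:Z - 1 = n%:Z by lia.
Qed.

Lemma lcons_inj (x : int * label) : injective (lcons x).
Proof. by move=> [s e] [s' e'] [-> ->]. Qed.

(** Labels separate the [Ld] block from the other two; the two [Lc] blocks differ in the first term
    of the tail. *)
Lemma Fseq_uniq (k : nat) : uniq (Fseq k).
Proof.
elim/nat_ind2: k => // k IH0 IH1.
rewrite FseqSS !cat_uniq !map_inj_uniq ?IH0 ?IH1 /= ?andbT; try exact: lcons_inj.
apply/andP; split; apply/hasPn => f.
  rewrite mem_cat => /orP[] /mapP[[s e] gin ->]; apply/mapP => -[[s' e'] gin'] //.
  case=> ss ee; move: gin gin'; rewrite ss ee => /FseqP[/= ft _ _].
  by case/(FseqP k.+1 (s', e')) => /= ft' _ _; lia.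
by move=> /mapP[[s e] gin ->]; apply/mapP => -[[s' e'] gin'].
Qed.

(** * Weights and summation over the sequences *)

(** The factors 1 stand for indices outside a given index set, so this is the joint contribution of
    one index to all three products. *)
Definition step_weight (b : seq nat) (t : bool) (m : int) (l : label) (m' : int) :
    ratfun :=
  let beta := `|(entry b m)%:Z - t%:Z|%N in
  let s := (-1) ^ (m - 1) in
  match l with
  | Lc => (if m - m' == 1 then weightL s beta else 1)
          * (if m - m' == 2 then weightR s (entry b (m - 1)) beta else 1)
  | Ld => if m - m' == 1 then weightG s beta else 1
  end.

(* The summand of a labelled sequence whose first term has correction t. *)
Fixpoint seq_weight (b : seq nat) (t : bool) (s : seq (int * label)) (e : int) :
    ratfun :=
  if s is (m, l) :: s'
  then step_weight b t m l (first_term s' e) * seq_weight b (l == Ld) s' e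
  else xfin e ((entry b e)%:Z - t%:Z).

(* Agrees with tcorr, except that t is the correction of the first term. *)
Definition label_shift (t : bool) (s : seq (int * label)) (i : nat) : bool :=
  nth false (t :: [seq x.2 == Ld | x <- s]) i.-1.

Lemma label_shift_tcorr (f : lseq) (i : nat) :
  (label_shift false f.1 i : nat) = tcorr f i.
Proof.
rewrite /label_shift /tcorr /lab.
case: i => [|[|i]] //=; congr nat_of_bool.
by elim: f.1 i => [|x s IH] [|i] /=.
Qed.

Lemma seq_weightE (b : seq nat) (t : bool) (f : lseq) :
  xfin (term f (len f)) ((entry b (term f (len f)))%:Z - (label_shift t f.1 (len f))%:Z)
  * \prod_(1 <= i < len f)
      step_weight b (label_shift t f.1 i) (term f i) (lab f i) (term f i.+1)
  = seq_weight b t f.1 f.2.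
Proof.
case: f => s e; elim: s t => [|[m l] s IH] t; first by rewrite big_geq ?mulr1.
have lenS x : len (x :: s, e) = (len (s, e)).+1 by [].
have len1 : (0 < len (s, e))%N by rewrite /len /terms size_rcons.
have termS i : term ((m, l) :: s, e) i.+2 = term (s, e) i.+1 by [].
have shiftS i : label_shift t ((m, l) :: s) i.+2 = label_shift (l == Ld) s i.+1 by [].
rewrite /= -IH lenS big_ltn // big_add1 /= mulrCA; congr (_ * _).
  by rewrite /term /first_term; case: (s).
case: (len (s, e)) len1 => // k _.
rewrite termS shiftS; congr (_ * _).
rewrite !big_add1; apply: eq_bigr => i _.
by rewrite !termS shiftS.
Qed.

(** The three blocks of [Fseq] match the three terms of [partial_polySS]. At [k = 0] only
    [t = false] is required, since a term labelled [d] drops by 1 and the recursion sets [t] only on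
    [Fseq k.+1]. *)
Lemma sum_seq_weight (P : diagram -> ratfun) (hP : dubrovnik P) (b : seq nat) :
  (forall i, (i < size b)%N -> (0 < nth 0%N b i)%N) ->
  forall k t, (k <= (size b).+1)%N -> (k = 0%N -> t = false) ->
  \sum_(f <- Fseq k) seq_weight b t f.1 f.2 = partial_poly P b k t.
Proof.
move=> bpos; elim/nat_ind2 => [t _ ->|[]|k IH0 IH1 t lek _] //.
- by rewrite big_seq1.
- by rewrite big_seq1.
- by rewrite big_seq1.
rewrite FseqSS !big_cat !big_map.
have head_weight l j :
    \sum_(f <- Fseq j) seq_weight b t (lcons (k.+1%:Z, l) f).1 (lcons (k.+1%:Z, l) f).2
    = step_weight b t k.+1 l (j%:Z - 1)
      * \sum_(f <- Fseq j) seq_weight b (l == Ld) f.1 f.2.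
  rewrite mulr_sumr; apply: eq_big_seq => f /FseqP[ft _ _] /=.
  by rewrite ft.
rewrite !head_weight !IH0 ?IH1 //; try lia.
rewrite partial_polySS //; last by move=> i ltik; apply: bpos; lia.
have sE : (-1) ^ (k.+1%:Z - 1) = parity_sign (odd k.+1) :> int.
  have -> : k.+1%:Z - 1 = k by lia.
  by rewrite -exprnP -signr_odd /=; case: (odd k).
(* Since [b] is positive here, absolute value and truncated subtraction agree. *)
have bE : `|(entry b k.+1)%:Z - t%:Z|%N = (nth 0%N b k - t)%N.
  have := bpos k; case: (t) => /=; lia.
have eE : entry b (k.+1%:Z - 1) = entry b k by congr entry; lia.
have d1 : k.+1%:Z - (k.+1%:Z - 1) = 1 by lia.
have d2 : k.+1%:Z - (k%:Z - 1) = 2 by lia.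
rewrite /step_weight sE bE eE d1 d2 /= mulr1 mul1r.
by ring.
Qed.

Theorem theorem4 (P : diagram -> ratfun) (hP : dubrovnik P)
    (n : nat) (b : n.-tuple nat) (hn : (1 <= n)%N)
    (hb : forall i : 'I_n, (0 < tnth b i)%N) :
  P (standard_diagram b) =
    \sum_(f \in Fset n)
      (xfin (term f (len f)) (beta b f (len f))
       * \prod_(1 <= i < len f | in_lambda f i) Lambda b f i
       * \prod_(1 <= i < len f | in_rho f i) Rho b f i
       * \prod_(1 <= i < len f | in_gamma f i) Gamma b f i).
Proof.
rewrite Fset_Fseq -fsbig_seq ?Fseq_uniq //.
have bpos i : (i < size b)%N -> (0 < nth 0%N b i)%N.
  by rewrite size_tuple => ltin; rewrite -(tnth_nth 0%N b (Ordinal ltin)).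
(* First term [n] corresponds to [k = n + 1], because [k = 0] encodes the term -1. *)
transitivity (partial_poly P b n.+1 false).
  rewrite -word_polyE /= standard_wordE size_tuple.
  by case: n hn b {hb bpos} => // n _ b; rewrite /partial_poly subn0 /= /closing_poly.
rewrite -sum_seq_weight // ?size_tuple //.
apply: eq_bigr => f _; rewrite -seq_weightE label_shift_tcorr -!mulrA.
(* Filtered products become full products padded with 1, so they can be merged index by index. *)
congr (_ * _); rewrite (big_mkcond (in_lambda f)) (big_mkcond (in_rho f)).
rewrite (big_mkcond (in_gamma f)) -!big_split; apply: eq_bigr => i _ /=.
rewrite /in_lambda /in_rho /in_gamma /Lambda /Rho /Gamma /beta /sgn.
rewrite -label_shift_tcorr /step_weight -/(drop_by f i).
by case: (lab f i) => /=; rewrite ?mul1r ?mulr1.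
Qed.
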